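(* Let $T\in\mathcal{S}'(\mathbb{R})$, $\varphi\in\mathcal{S}(\mathbb{R})$ and $a\in\mathbb{R}$. Define the translated pair $(T_a,\varphi_a)$ by $\langle T_a,\psi\rangle:=\langle T,\psi(\cdot+a)\rangle$ for $\psi\in\mathcal{S}(\mathbb{R})$ and $\varphi_a(x):=\varphi(x-a)$. Let ${}^{(\varphi_a)}\phi_a$ be the weak characteristic function of $(T_a,\varphi_a)$. Then ${}^{(\varphi_a)}\phi_a(t)=e^{ita}\,{}^{(\varphi)}\phi(t)$ for all $t\in\mathbb{R}$, and, whenever the weak cumulants are defined (${}^{(\varphi)}\phi\ne0$ near $0$), $${}^{(\varphi_a)}\kappa_1={}^{(\varphi)}\kappa_1+a,\qquad {}^{(\varphi_a)}\kappa_n={}^{(\varphi)}\kappa_n\quad(n\ge2),$$ where ${}^{(\varphi_a)}\kappa_n$ are the weak cumulants of $(T_a,\varphi_a)$ and ${}^{(\varphi)}\kappa_n$ those of $(T,\varphi)$.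
   Context: $\mathcal{S}(\mathbb{R})$, $\mathcal{S}'(\mathbb{R})$ denote Schwartz functions and tempered distributions. The weak characteristic function of a pair $(T,\varphi)$ is ${}^{(\varphi)}\phi(t):=\langle T,e^{itx}\varphi(x)\rangle$. When it is nonzero near $0$, the weak cumulant generating function is ${}^{(\varphi)}K(t):=\log{}^{(\varphi)}\phi(t)$ (any continuous branch near $0$), and the $n$-th weak cumulant ($n\ge1$) is ${}^{(\varphi)}\kappa_n:=i^{-n}\frac{d^n}{dt^n}{}^{(\varphi)}K(t)\big|_{t=0}$. *)

(* Defs.v *)
(* Stdlib reals with Coquelicot; functions take values in Coquelicot's C. *)
From Stdlib Require Import Reals Lra Lia.
From Stdlib Require Import ClassicalEpsilon FunctionalExtensionality ProofIrrelevance.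
From Coquelicot Require Import Coquelicot.

Open Scope R_scope.

Definition Cexp (z : C) : C := (exp (Re z) * cos (Im z), exp (Re z) * sin (Im z)).

(* Derivatives of complex-valued functions of a real variable are componentwise. *)
Definition CDerive_n (f : R -> C) (n : nat) (x : R) : C :=
  (Derive_n (fun y => Re (f y)) n x, Derive_n (fun y => Im (f y)) n x).

Definition Csmooth (f : R -> C) : Prop :=
  forall (n : nat) (x : R),
    ex_derive_n (fun y => Re (f y)) n x /\ ex_derive_n (fun y => Im (f y)) n x.

Definition is_schwartz (f : R -> C) : Prop :=
  Csmooth f /\
  forall m n : nat, exists M : R, forall x : R, Rabs x ^ m * Cmod (CDerive_n f n x) <= M.

Record schwartz : Type := mk_schwartz {
  schwartz_fun :> R -> C;
  schwartz_prop : is_schwartz schwartz_fun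
}.

(* The seminorm sup_x |x|^m |f^(n)(x)|, finite for f in the Schwartz space. *)
Definition seminorm (m n : nat) (f : R -> C) : R :=
  real (Lub_Rbar (fun y : R => exists x : R, y = Rabs x ^ m * Cmod (CDerive_n f n x))).

(* Neighbourhood filter of f in the locally convex topology of the Schwartz
   space: the m, n <= N, r > 0 give a basis of neighbourhoods. *)
Definition schwartz_nbhs (f : schwartz) (P : schwartz -> Prop) : Prop :=
  exists (N : nat) (r : posreal), forall g : schwartz,
    (forall m n : nat, (m <= N)%nat -> (n <= N)%nat ->
       seminorm m n (fun x => (g x - f x)%C) < r) ->
    P g.

Lemma schwartz_ext (f g : schwartz) : (forall x, f x = g x) -> f = g.
Proof.
  destruct f as [f Hf], g as [g Hg]; simpl; intros H.
  assert (E : f = g) by (apply functional_extensionality; exact H).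
  subst g; f_equal; apply proof_irrelevance.
Qed.

Lemma jet_derive_n (F : nat -> R -> R) :
  (forall n x, is_derive (F n) x (F (S n) x)) ->
  forall n, (forall x, Derive_n (F 0%nat) n x = F n x)
            /\ (forall x, ex_derive_n (F 0%nat) n x).
Proof.
  intros H.
  assert (H1 : forall n x, Derive_n (F 0%nat) n x = F n x).
  { induction n as [|n IH]; intros x; [reflexivity|]; simpl.
    rewrite (Derive_ext _ (F n)) by exact IH.
    apply is_derive_unique, H. }
  intros n; split; [apply H1|].
  destruct n as [|n]; intros x; [exact I|]; simpl.
  apply ex_derive_ext with (F n); [intros t; symmetry; apply H1|].
  eexists; apply H.
Qed.

Lemma jet_CDerive_n (F : nat -> R -> C) :
  (forall n x, is_derive (fun y => Re (F n y)) x (Re (F (S n) x))) ->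
  (forall n x, is_derive (fun y => Im (F n y)) x (Im (F (S n) x))) ->
  Csmooth (F 0%nat) /\ forall n x, CDerive_n (F 0%nat) n x = F n x.
Proof.
  intros HR HI.
  pose proof (jet_derive_n (fun n y => Re (F n y)) HR) as JR.
  pose proof (jet_derive_n (fun n y => Im (F n y)) HI) as JI.
  split.
  - intros n x; split; [apply JR|apply JI].
  - intros n x; unfold CDerive_n.
    rewrite (proj1 (JR n)), (proj1 (JI n)).
    destruct (F n x); reflexivity.
Qed.

Lemma is_derive_CDerive_n (f : R -> C) (n : nat) (x : R) :
  Csmooth f ->
  is_derive (fun y => Re (CDerive_n f n y)) x (Re (CDerive_n f (S n) x)) /\
  is_derive (fun y => Im (CDerive_n f n y)) x (Im (CDerive_n f (S n) x)).
Proof.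
  intros H; destruct (H (S n) x) as [HR HI]; simpl in *.
  split; apply Derive_correct; assumption.
Qed.

Lemma is_schwartz_jet (F : nat -> R -> C) :
  (forall n x, is_derive (fun y => Re (F n y)) x (Re (F (S n) x))) ->
  (forall n x, is_derive (fun y => Im (F n y)) x (Im (F (S n) x))) ->
  (forall m n, exists M, forall x, Rabs x ^ m * Cmod (F n x) <= M) ->
  is_schwartz (F 0%nat).
Proof.
  intros HR HI HB; destruct (jet_CDerive_n F HR HI) as [HS HD]; split; [exact HS|].
  intros m n; destruct (HB m n) as [M HM]; exists M; intros x; rewrite HD; apply HM.
Qed.

Lemma is_schwartz_plus (f g : schwartz) : is_schwartz (fun x => (f x + g x)%C).
Proof.
  destruct f as [f [Sf Bf]], g as [g [Sg Bg]]; simpl.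
  assert (H : is_schwartz ((fun n x => (CDerive_n f n x + CDerive_n g n x)%C) 0%nat)).
  { apply (is_schwartz_jet (fun n x => (CDerive_n f n x + CDerive_n g n x)%C)).
    - intros n x; exact (is_derive_plus _ _ _ _ _
        (proj1 (is_derive_CDerive_n f n x Sf)) (proj1 (is_derive_CDerive_n g n x Sg))).
    - intros n x; exact (is_derive_plus _ _ _ _ _
        (proj2 (is_derive_CDerive_n f n x Sf)) (proj2 (is_derive_CDerive_n g n x Sg))).
    - intros m n; destruct (Bf m n) as [A HA], (Bg m n) as [B HB].
      exists (A + B); intros x.
      apply Rle_trans with (Rabs x ^ m * (Cmod (CDerive_n f n x) + Cmod (CDerive_n g n x))).
      + apply Rmult_le_compat_l; [apply pow_le, Rabs_pos|apply Cmod_triangle].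
      + rewrite Rmult_plus_distr_l; apply Rplus_le_compat; auto. }
  simpl in H; unfold CDerive_n in H; simpl in H.
  replace (fun x => (f x + g x)%C) with
    (fun x => ((Re (f x), Im (f x)) + (Re (g x), Im (g x)))%C); [exact H|].
  apply functional_extensionality; intros x; destruct (f x), (g x); reflexivity.
Qed.

Lemma is_schwartz_scal (c : C) (f : schwartz) : is_schwartz (fun x => (c * f x)%C).
Proof.
  destruct f as [f [Sf Bf]]; simpl.
  assert (H : is_schwartz ((fun n x => (c * CDerive_n f n x)%C) 0%nat)).
  { apply (is_schwartz_jet (fun n x => (c * CDerive_n f n x)%C)).
    - intros n x; destruct (is_derive_CDerive_n f n x Sf) as [HR HI].
      exact (is_derive_minus _ _ _ _ _
        (is_derive_scal _ _ (Re c) _ HR) (is_derive_scal _ _ (Im c) _ HI)).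
    - intros n x; destruct (is_derive_CDerive_n f n x Sf) as [HR HI].
      exact (is_derive_plus _ _ _ _ _
        (is_derive_scal _ _ (Re c) _ HI) (is_derive_scal _ _ (Im c) _ HR)).
    - intros m n; destruct (Bf m n) as [A HA].
      exists (Cmod c * A); intros x; rewrite Cmod_mult.
      replace (Rabs x ^ m * (Cmod c * Cmod (CDerive_n f n x)))
        with (Cmod c * (Rabs x ^ m * Cmod (CDerive_n f n x))) by ring.
      apply Rmult_le_compat_l; [apply Cmod_ge_0|auto]. }
  simpl in H; unfold CDerive_n in H; simpl in H.
  replace (fun x => (c * f x)%C) with
    (fun x => (c * (Re (f x), Im (f x)))%C); [exact H|].
  apply functional_extensionality; intros x; destruct (f x); reflexivity.
Qed.

Lemma is_schwartz_derive (f : schwartz) : is_schwartz (CDerive_n f 1).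
Proof.
  destruct f as [f [Sf Bf]]; simpl.
  apply (is_schwartz_jet (fun n x => CDerive_n f (S n) x)).
  - intros n x; apply is_derive_CDerive_n, Sf.
  - intros n x; apply is_derive_CDerive_n, Sf.
  - intros m n; apply Bf.
Qed.

Definition schwartz_plus (f g : schwartz) : schwartz :=
  mk_schwartz (fun x => (f x + g x)%C) (is_schwartz_plus f g).

Definition schwartz_scal (c : C) (f : schwartz) : schwartz :=
  mk_schwartz (fun x => (c * f x)%C) (is_schwartz_scal c f).

Definition schwartz_derive (f : schwartz) : schwartz :=
  mk_schwartz (CDerive_n f 1) (is_schwartz_derive f).

Lemma Cexp_Ci (t x : R) :
  Cexp (Ci * RtoC t * RtoC x) = (cos (t * x), sin (t * x)).
Proof.
  unfold Cexp; simpl.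
  replace ((0 * t - 1 * 0) * x - (0 * 0 + 1 * t) * 0) with 0 by ring.
  replace ((0 * t - 1 * 0) * 0 + (0 * 0 + 1 * t) * x) with (t * x) by ring.
  rewrite exp_0, !Rmult_1_l; reflexivity.
Qed.

Lemma Cmod_Cexp_Ci (t x : R) : Cmod (Cexp (Ci * RtoC t * RtoC x)) = 1.
Proof.
  rewrite Cexp_Ci; unfold Cmod; simpl; rewrite !Rmult_1_r.
  replace (cos (t * x) * cos (t * x) + sin (t * x) * sin (t * x)) with 1.
  - apply sqrt_1.
  - generalize (sin2_cos2 (t * x)); unfold Rsqr; intros H; lra.
Qed.

(* The n-th derivative of e^{itx} f(x) is e^{itx} times (d/dx + it)^n f. *)
Fixpoint modulate_jet (t : R) (f : schwartz) (n : nat) : schwartz :=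
  match n with
  | O => f
  | S k => let g := modulate_jet t f k in
           schwartz_plus (schwartz_derive g) (schwartz_scal (Ci * RtoC t)%C g)
  end.

Lemma is_schwartz_modulate (t : R) (f : schwartz) :
  is_schwartz (fun x => (Cexp (Ci * RtoC t * RtoC x) * f x)%C).
Proof.
  apply (is_schwartz_jet
           (fun n x => (Cexp (Ci * RtoC t * RtoC x) * modulate_jet t f n x)%C)).
  - intros n x; simpl modulate_jet; set (g := modulate_jet t f n).
    destruct (is_derive_CDerive_n g 0 x (proj1 (schwartz_prop g))) as [HR HI].
    simpl in HR, HI.
    apply is_derive_ext with
      (fun y => cos (t * y) * Re (g y) - sin (t * y) * Im (g y)).
    { intros y; rewrite Cexp_Ci; reflexivity. }
    assert (HC : is_derive (fun y => cos (t * y)) x (- t * sin (t * x)))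
      by (auto_derive; [exact I|ring]).
    assert (HS : is_derive (fun y => sin (t * y)) x (t * cos (t * x)))
      by (auto_derive; [exact I|ring]).
    evar_last.
    { exact (is_derive_minus _ _ _ _ _
        (is_derive_mult _ _ _ _ _ HC HR Rmult_comm)
        (is_derive_mult _ _ _ _ _ HS HI Rmult_comm)). }
    rewrite Cexp_Ci; unfold minus, plus, opp, mult; simpl; unfold Re, Im; simpl; ring.
  - intros n x; simpl modulate_jet; set (g := modulate_jet t f n).
    destruct (is_derive_CDerive_n g 0 x (proj1 (schwartz_prop g))) as [HR HI].
    simpl in HR, HI.
    apply is_derive_ext with
      (fun y => cos (t * y) * Im (g y) + sin (t * y) * Re (g y)).
    { intros y; rewrite Cexp_Ci; reflexivity. }
    assert (HC : is_derive (fun y => cos (t * y)) x (- t * sin (t * x)))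
      by (auto_derive; [exact I|ring]).
    assert (HS : is_derive (fun y => sin (t * y)) x (t * cos (t * x)))
      by (auto_derive; [exact I|ring]).
    evar_last.
    { exact (is_derive_plus _ _ _ _ _
        (is_derive_mult _ _ _ _ _ HC HI Rmult_comm)
        (is_derive_mult _ _ _ _ _ HS HR Rmult_comm)). }
    rewrite Cexp_Ci; unfold plus, mult; simpl; unfold Re, Im; simpl; ring.
  - intros m n; destruct (proj2 (schwartz_prop (modulate_jet t f n)) m 0%nat) as [M HM].
    exists M; intros x; rewrite Cmod_mult, Cmod_Cexp_Ci, Rmult_1_l.
    specialize (HM x); unfold CDerive_n in HM; simpl in HM.
    destruct (modulate_jet t f n x); exact HM.
Qed.

Lemma CDerive_n_shift (f : R -> C) (a : R) (n : nat) (x : R) :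
  CDerive_n (fun y => f (y + a)) n x = CDerive_n f n (x + a).
Proof.
  unfold CDerive_n.
  rewrite (Derive_n_comp_trans (fun y => Re (f y))).
  rewrite (Derive_n_comp_trans (fun y => Im (f y))); reflexivity.
Qed.

Lemma pow_plus_le (u v : R) (m : nat) :
  0 <= u -> 0 <= v -> (u + v) ^ m <= 2 ^ m * (u ^ m + v ^ m).
Proof.
  intros Hu Hv.
  apply Rle_trans with ((2 * Rmax u v) ^ m).
  - apply pow_incr; split; [lra|].
    generalize (Rmax_l u v) (Rmax_r u v); lra.
  - rewrite Rpow_mult_distr; apply Rmult_le_compat_l; [apply pow_le; lra|].
    generalize (pow_le u m Hu) (pow_le v m Hv); intros.
    unfold Rmax; destruct (Rle_dec u v); lra.
Qed.

Lemma shift_bound (f : R -> C) (a : R) (m n : nat) (A B : R) :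
  (forall x, Rabs x ^ m * Cmod (CDerive_n f n x) <= A) ->
  (forall x, Rabs x ^ 0 * Cmod (CDerive_n f n x) <= B) ->
  forall x, Rabs x ^ m * Cmod (CDerive_n (fun y => f (y + a)) n x)
            <= 2 ^ m * (A + Rabs a ^ m * B).
Proof.
  intros HA HB x; rewrite CDerive_n_shift.
  specialize (HA (x + a)); specialize (HB (x + a)); simpl in HB; rewrite Rmult_1_l in HB.
  set (q := Cmod _) in *.
  assert (Hq : 0 <= q) by apply Cmod_ge_0.
  apply Rle_trans with (2 ^ m * (Rabs (x + a) ^ m + Rabs a ^ m) * q).
  - apply Rmult_le_compat_r; [exact Hq|].
    apply Rle_trans with ((Rabs (x + a) + Rabs a) ^ m).
    + apply pow_incr; split; [apply Rabs_pos|].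
      replace x with ((x + a) + - a) at 1 by ring.
      rewrite <- (Rabs_Ropp a); apply Rabs_triang.
    + apply pow_plus_le; apply Rabs_pos.
  - rewrite Rmult_assoc; apply Rmult_le_compat_l; [apply pow_le; lra|].
    rewrite Rmult_plus_distr_r; apply Rplus_le_compat; [exact HA|].
    apply Rmult_le_compat_l; [apply pow_le, Rabs_pos|exact HB].
Qed.

Lemma Csmooth_shift (f : R -> C) (a : R) : Csmooth f -> Csmooth (fun x => f (x + a)).
Proof.
  intros H.
  set (F := fun n x => CDerive_n f n (x + a)).
  assert (HF : forall n x,
    is_derive (fun y => Re (F n y)) x (Re (F (S n) x)) /\
    is_derive (fun y => Im (F n y)) x (Im (F (S n) x))).
  { intros n x; unfold F.
    assert (Ha : is_derive (fun y : R => y + a) x 1) by (auto_derive; [exact I|ring]).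
    destruct (is_derive_CDerive_n f n (x + a) H) as [HR HI].
    split; (evar_last; [|apply Rmult_1_l]).
    - exact (is_derive_comp (fun y => Re (CDerive_n f n y)) _ _ _ _ HR Ha).
    - exact (is_derive_comp (fun y => Im (CDerive_n f n y)) _ _ _ _ HI Ha). }
  exact (proj1 (jet_CDerive_n F (fun n x => proj1 (HF n x)) (fun n x => proj2 (HF n x)))).
Qed.

Lemma is_schwartz_shift (a : R) (f : schwartz) : is_schwartz (fun x => f (x + a)).
Proof.
  destruct f as [f [Sf Bf]]; simpl; split; [apply Csmooth_shift, Sf|].
  intros m n; destruct (Bf m n) as [A HA], (Bf 0%nat n) as [B HB].
  eexists; apply (shift_bound f a m n A B HA HB).
Qed.

Definition schwartz_modulate (t : R) (f : schwartz) : schwartz :=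
  mk_schwartz (fun x => (Cexp (Ci * RtoC t * RtoC x) * f x)%C) (is_schwartz_modulate t f).

Definition schwartz_shift (a : R) (f : schwartz) : schwartz :=
  mk_schwartz (fun x => f (x + a)) (is_schwartz_shift a f).

Record tempered : Type := mk_tempered {
  tempered_fun :> schwartz -> C;
  tempered_plus : forall f g : schwartz,
    tempered_fun (schwartz_plus f g) = (tempered_fun f + tempered_fun g)%C;
  tempered_scal : forall (c : C) (f : schwartz),
    tempered_fun (schwartz_scal c f) = (c * tempered_fun f)%C;
  tempered_continuous : forall f : schwartz,
    filterlim tempered_fun (schwartz_nbhs f) (locally (tempered_fun f))
}.

Lemma seminorm_ub (m n : nat) (f : schwartz) (x : R) :
  Rabs x ^ m * Cmod (CDerive_n f n x) <= seminorm m n f.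
Proof.
  unfold seminorm.
  destruct (Lub_Rbar_correct
    (fun y : R => exists x : R, y = Rabs x ^ m * Cmod (CDerive_n f n x))) as [Hub Hlub].
  destruct (proj2 (schwartz_prop f) m n) as [M HM].
  assert (H1 := Hub _ (ex_intro _ x eq_refl)).
  assert (H2 : Rbar_le (Lub_Rbar
    (fun y : R => exists x : R, y = Rabs x ^ m * Cmod (CDerive_n f n x))) M).
  { apply Hlub; intros y [z ->]; apply HM. }
  destruct (Lub_Rbar _); simpl in *; [exact H1|contradiction|contradiction].
Qed.

Lemma seminorm_le (m n : nat) (f : R -> C) (M : R) :
  (forall x, Rabs x ^ m * Cmod (CDerive_n f n x) <= M) -> seminorm m n f <= M.
Proof.
  intros HM; unfold seminorm.
  destruct (Lub_Rbar_correct
    (fun y : R => exists x : R, y = Rabs x ^ m * Cmod (CDerive_n f n x))) as [Hub Hlub].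
  assert (H1 := Hub _ (ex_intro _ 0 eq_refl)).
  assert (H2 : Rbar_le (Lub_Rbar
    (fun y : R => exists x : R, y = Rabs x ^ m * Cmod (CDerive_n f n x))) M).
  { apply Hlub; intros y [z ->]; apply HM. }
  destruct (Lub_Rbar _); simpl in *; [exact H2|contradiction|contradiction].
Qed.

Lemma schwartz_shift_continuous (a : R) (f : schwartz) :
  filterlim (schwartz_shift a) (schwartz_nbhs f) (schwartz_nbhs (schwartz_shift a f)).
Proof.
  intros P [N [r HP]].
  set (c := 2 ^ N * (1 + (1 + Rabs a) ^ N)).
  assert (Ha := Rabs_pos a).
  assert (Hc : 0 < c).
  { apply Rmult_lt_0_compat; [apply pow_lt; lra|].
    assert (H := pow_le (1 + Rabs a) N ltac:(lra)); lra. }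
  assert (Hr : 0 < r / (2 * c)) by (apply Rdiv_lt_0_compat; [apply cond_pos|lra]).
  exists N, (mkposreal (r / (2 * c)) Hr).
  intros g Hg; apply HP; intros m n Hm Hn; simpl in Hg.
  set (h := schwartz_plus g (schwartz_scal (RtoC (-1)) f)).
  assert (Eh : (fun x => (g x - f x)%C) = h).
  { apply functional_extensionality; intros x; simpl.
    destruct (g x), (f x); apply injective_projections; simpl; ring. }
  rewrite Eh in Hg.
  change (fun x => (schwartz_shift a g x - schwartz_shift a f x)%C)
    with (fun x => (fun y => (g y - f y)%C) (x + a)); rewrite Eh.
  apply Rle_lt_trans with (r / 2); [|generalize (cond_pos r); lra].
  apply seminorm_le; intros x.
  eapply Rle_trans.
  { apply (shift_bound h a m n (r / (2 * c)) (r / (2 * c))).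
    - intros z; left; eapply Rle_lt_trans; [apply seminorm_ub|auto].
    - intros z; left; eapply Rle_lt_trans; [apply seminorm_ub|apply Hg; auto with arith]. }
  replace (pos r / 2) with (c * (r / (2 * c))) by (field; lra).
  replace (2 ^ m * (r / (2 * c) + Rabs a ^ m * (r / (2 * c))))
    with (2 ^ m * (1 + Rabs a ^ m) * (r / (2 * c))) by ring.
  apply Rmult_le_compat_r.
  { left; exact Hr. }
  unfold c; apply Rmult_le_compat.
  - apply pow_le; lra.
  - generalize (pow_le (Rabs a) m Ha); lra.
  - apply Rle_pow; [lra|exact Hm].
  - apply Rplus_le_compat_l.
    apply Rle_trans with ((1 + Rabs a) ^ m); [apply pow_incr; lra|].
    apply Rle_pow; [lra|exact Hm].
Qed.

Lemma tempered_translate_plus (a : R) (T : tempered) (f g : schwartz) :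
  T (schwartz_shift a (schwartz_plus f g)) =
  (T (schwartz_shift a f) + T (schwartz_shift a g))%C.
Proof.
  rewrite <- tempered_plus; f_equal; apply schwartz_ext; reflexivity.
Qed.

Lemma tempered_translate_scal (a : R) (T : tempered) (c : C) (f : schwartz) :
  T (schwartz_shift a (schwartz_scal c f)) = (c * T (schwartz_shift a f))%C.
Proof.
  rewrite <- tempered_scal; f_equal; apply schwartz_ext; reflexivity.
Qed.

Lemma tempered_translate_continuous (a : R) (T : tempered) (f : schwartz) :
  filterlim (fun psi => T (schwartz_shift a psi)) (schwartz_nbhs f)
    (locally (T (schwartz_shift a f))).
Proof.
  eapply filterlim_comp; [apply schwartz_shift_continuous|apply tempered_continuous].
Qed.

(* <T_a, psi> = <T, psi(. + a)> *)
Definition tempered_translate (a : R) (T : tempered) : tempered :=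
  mk_tempered (fun psi => T (schwartz_shift a psi))
    (tempered_translate_plus a T) (tempered_translate_scal a T)
    (tempered_translate_continuous a T).

(* phi_a(x) = phi(x - a) *)
Definition schwartz_translate (a : R) (phi : schwartz) : schwartz :=
  schwartz_shift (- a) phi.

Definition weak_cf (T : tempered) (phi : schwartz) (t : R) : C :=
  T (schwartz_modulate t phi).

Definition nonzero_near_0 (f : R -> C) : Prop := locally 0 (fun t => f t <> RtoC 0).

(* K is a continuous branch of log f near 0. *)
Definition is_log_branch (f K : R -> C) : Prop :=
  locally 0 (fun t => continuous K t /\ Cexp (K t) = f t).

(* Some continuous branch of the logarithm of the weak characteristic function
   near 0 (arbitrary when there is none); the cumulants do not depend on the
   choice, see weak_cumulant_branch. *)
Definition weak_cgf (T : tempered) (phi : schwartz) : R -> C :=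
  epsilon (inhabits (fun _ => RtoC 0)) (is_log_branch (weak_cf T phi)).

Definition weak_cumulant (T : tempered) (phi : schwartz) (n : nat) : C :=
  (/ Ci ^ n * CDerive_n (weak_cgf T phi) n 0)%C.

Lemma Cexp_eq_near (z w z0 w0 : C) :
  Cexp z = Cexp w -> Cexp z0 = Cexp w0 ->
  Rabs (Im z - Im z0) < 1 -> Rabs (Im w - Im w0) < 1 ->
  (z - z0)%C = (w - w0)%C.
Proof.
  assert (HRe : forall u v, Cexp u = Cexp v ->
    Re u = Re v /\ cos (Im u) = cos (Im v) /\ sin (Im u) = sin (Im v)).
  { intros [u1 u2] [v1 v2]; unfold Cexp; simpl; intros H; injection H; intros Hs Hc.
    assert (E : exp u1 * exp u1 = exp v1 * exp v1).
    { generalize (sin2_cos2 u2) (sin2_cos2 v2); unfold Rsqr; intros Hu Hv.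
      transitivity (exp u1 * cos u2 * (exp u1 * cos u2) + exp u1 * sin u2 * (exp u1 * sin u2)).
      - transitivity (exp u1 * exp u1 * (sin u2 * sin u2 + cos u2 * cos u2)); [|ring].
        rewrite Hu; ring.
      - rewrite Hc, Hs.
        transitivity (exp v1 * exp v1 * (sin v2 * sin v2 + cos v2 * cos v2)); [ring|].
        rewrite Hv; ring. }
    assert (E1 : u1 = v1).
    { rewrite <- !exp_plus in E; apply exp_inv in E; lra. }
    subst v1; assert (Hp := exp_pos u1).
    repeat split; eapply Rmult_eq_reg_l; eauto; lra. }
  intros H H0 Hz Hw.
  destruct (HRe _ _ H) as (R1 & C1 & S1), (HRe _ _ H0) as (R0 & C0 & S0).
  destruct z as [z1 z2], w as [w1 w2], z0 as [x1 x2], w0 as [y1 y2]; simpl in *.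
  set (d := (z2 - x2) - (w2 - y2)).
  assert (Hd : sin d = 0).
  { unfold d.
    rewrite sin_minus, !sin_minus, !cos_minus, C1, S1, C0, S0; ring. }
  assert (Bd : - PI < d < PI).
  { generalize PI2_1; unfold PI2; intros HP.
    apply Rabs_def2 in Hz; apply Rabs_def2 in Hw; unfold d; lra. }
  assert (d = 0).
  { destruct (Rtotal_order d 0) as [L|[L|L]]; [|exact L|].
    - generalize (sin_gt_0 (- d)); rewrite sin_neg; lra.
    - generalize (sin_gt_0 d); lra. }
  unfold d in *; unfold Cminus, Cplus, Copp; simpl; f_equal; lra.
Qed.

Lemma continuous_Im_near (K : R -> C) :
  continuous K 0 -> locally 0 (fun t => Rabs (Im (K t) - Im (K 0)) < 1).
Proof.
  intros H.
  assert (H2 : continuous (fun t => Im (K t)) 0).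
  { apply (continuous_comp K (fun z : C => snd z)); [exact H|apply continuous_snd]. }
  exact (H2 _ (locally_ball (Im (K 0)) (mkposreal 1 Rlt_0_1))).
Qed.

Lemma weak_cumulant_branch (T : tempered) (phi : schwartz) (K : R -> C) (n : nat) :
  (1 <= n)%nat -> is_log_branch (weak_cf T phi) K ->
  weak_cumulant T phi n = (/ Ci ^ n * CDerive_n K n 0)%C.
Proof.
  intros Hn HK.
  assert (HL : is_log_branch (weak_cf T phi) (weak_cgf T phi)).
  { unfold weak_cgf; apply epsilon_spec; exists K; exact HK. }
  unfold weak_cumulant; f_equal; revert HL; generalize (weak_cgf T phi) as L; intros L HL.
  destruct (locally_singleton _ _ HK) as [CK EK], (locally_singleton _ _ HL) as [CL EL].
  assert (H : locally 0 (fun t => (L t - L 0)%C = (K t - K 0)%C)).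
  { generalize (filter_and _ _ (filter_and _ _ HK HL)
      (filter_and _ _ (continuous_Im_near K CK) (continuous_Im_near L CL))).
    apply filter_imp; intros t [[[_ Kt] [_ Lt]] [BK BL]].
    apply Cexp_eq_near; congruence || assumption. }
  destruct n as [|n]; [lia|].
  assert (Hc : forall (f : R -> R) c, Derive_n (fun t => f t + c) (S n) 0 = Derive_n f (S n) 0).
  { intros f c; rewrite <- Nat.add_1_r, <- !Derive_n_comp.
    apply Derive_n_ext; intros t; simpl; unfold Derive; f_equal.
    apply Lim_ext; intros h; f_equal; ring. }
  unfold CDerive_n; f_equal.
  - rewrite <- (Hc (fun y => Re (K y)) (Re (L 0) - Re (K 0))).
    apply Derive_n_ext_loc; revert H; apply filter_imp; intros t E.
    apply (f_equal Re) in E; destruct (L t), (K t), (L 0), (K 0); simpl in *; lra.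
  - rewrite <- (Hc (fun y => Im (K y)) (Im (L 0) - Im (K 0))).
    apply Derive_n_ext_loc; revert H; apply filter_imp; intros t E.
    apply (f_equal Im) in E; destruct (L t), (K t), (L 0), (K 0); simpl in *; lra.
Qed.

(* Main.v *)
(** The second-order Taylor remainder (e^{ihx} - 1 - ihx) f(x) is O(h^2) in every
    Schwartz seminorm: its x-derivative is the same remainder for f' plus
    ih (e^{ihx} - 1) f(x), so one inducts on the order of the seminorm. Hence the
    weak characteristic function is differentiable, and where it does not vanish
    it has a differentiable branch of the logarithm K. Translating the pair
    multiplies the characteristic function by e^{ita}, so K(t) + ita is a branch
    for the translated pair. *)

Require Import Defs.
From Stdlib Require Import Reals Lra Lia FunctionalExtensionality.
From Coquelicot Require Import Coquelicot.

(** * Calculus on Schwartz functions: sums, multiples, multiplication by x, modulation *)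

Lemma weighted_Cmod_plus (w A B : R) (u v : C) :
  0 <= w -> w * Cmod u <= A -> w * Cmod v <= B -> w * Cmod (u + v)%C <= A + B.
Proof.
  intros Hw Hu Hv.
  apply Rle_trans with (w * (Cmod u + Cmod v)); [|lra].
  apply Rmult_le_compat_l; [exact Hw|apply Cmod_triangle].
Qed.

Lemma weighted_Cmod_mult (w A : R) (c v : C) :
  w * Cmod v <= A -> w * Cmod (c * v)%C <= Cmod c * A.
Proof.
  intros Hv; rewrite Cmod_mult.
  replace (w * (Cmod c * Cmod v)) with (Cmod c * (w * Cmod v)) by ring.
  apply Rmult_le_compat_l; [apply Cmod_ge_0|exact Hv].
Qed.

Lemma CDerive_n_plus (f g : schwartz) (n : nat) (x : R) :
  CDerive_n (schwartz_plus f g) n x = (CDerive_n f n x + CDerive_n g n x)%C.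
Proof.
  destruct f as [f [Sf Bf]], g as [g [Sg Bg]]; unfold CDerive_n; simpl.
  unfold Cplus; simpl; f_equal.
  - apply (Derive_n_plus (fun y => Re (f y)) (fun y => Re (g y)));
      apply filter_forall; intros y k _; [apply Sf|apply Sg].
  - apply (Derive_n_plus (fun y => Im (f y)) (fun y => Im (g y)));
      apply filter_forall; intros y k _; [apply Sf|apply Sg].
Qed.

Lemma CDerive_n_scal (c : C) (f : schwartz) (n : nat) (x : R) :
  CDerive_n (schwartz_scal c f) n x = (c * CDerive_n f n x)%C.
Proof.
  destruct f as [f [Sf Bf]]; unfold CDerive_n; simpl.
  unfold Cmult; simpl; f_equal.
  - rewrite <- !Derive_n_scal_l.
    apply (Derive_n_minus (fun y => Re c * Re (f y)) (fun y => Im c * Im (f y)));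
      apply filter_forall; intros y k _; apply ex_derive_n_scal_l, Sf.
  - rewrite <- !Derive_n_scal_l.
    apply (Derive_n_plus (fun y => Re c * Im (f y)) (fun y => Im c * Re (f y)));
      apply filter_forall; intros y k _; apply ex_derive_n_scal_l, Sf.
Qed.

Lemma CDerive_n_derive (f : schwartz) (n : nat) (x : R) :
  CDerive_n (schwartz_derive f) n x = CDerive_n f (S n) x.
Proof.
  unfold CDerive_n; f_equal; rewrite <- Nat.add_1_r, <- Derive_n_comp; reflexivity.
Qed.

(* [is_derive_ext] with the equation stated in [R], where [ring] recognises it. *)
Lemma is_derive_ext_R (f g : R -> R) (x l : R) :
  (forall y, f y = g y) -> is_derive f x l -> is_derive g x l.
Proof. exact (is_derive_ext f g x l). Qed.

(** Both components of a complex product have the shape p u + q v, so one rule serves for real and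
    imaginary parts. The value [l] is free up to an equation, which callers settle by [ring]. *)
Lemma is_derive_mult_plus_mult (p q u v : R -> R) (x p' q' u' v' l : R) :
  is_derive p x p' -> is_derive q x q' -> is_derive u x u' -> is_derive v x v' ->
  l = p' * u x + p x * u' + (q' * v x + q x * v') ->
  is_derive (fun y => p y * u y + q y * v y) x l.
Proof.
  intros Hp Hq Hu Hv ->.
  exact (is_derive_plus _ _ _ _ _ (is_derive_mult p u x p' u' Hp Hu Rmult_comm)
    (is_derive_mult q v x q' v' Hq Hv Rmult_comm)).
Qed.

Lemma CDerive_n_0 (f : R -> C) (x : R) : CDerive_n f 0 x = f x.
Proof. unfold CDerive_n; simpl; destruct (f x); reflexivity. Qed.

Lemma is_schwartz_mulx (f : schwartz) : is_schwartz (fun x => (RtoC x * f x)%C).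
Proof.
  (* Leibniz rule: the n-th derivative of x f is x f^(n) + n f^(n-1). At n = 0, [pred n] is again 0
     and the coefficient vanishes. *)
  set (F := fun n x =>
    (RtoC x * CDerive_n f n x + RtoC (INR n) * CDerive_n f (pred n) x)%C).
  assert (E : F 0%nat = fun x => (RtoC x * f x)%C).
  { apply functional_extensionality; intros x; unfold F.
    rewrite CDerive_n_0; simpl; ring. }
  assert (Sf := proj1 (schwartz_prop f)).
  rewrite <- E; apply is_schwartz_jet.
  - intros n x; unfold F.
    destruct (is_derive_CDerive_n f n x Sf) as [HR _].
    destruct (is_derive_CDerive_n f (pred n) x Sf) as [HR' _].
    apply is_derive_ext_R with
      (fun y => y * Re (CDerive_n f n y) + INR n * Re (CDerive_n f (pred n) y)).
    { intros y; simpl; unfold Re, Im; ring. }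
    eapply is_derive_mult_plus_mult;
      [apply is_derive_id|apply (is_derive_const (INR n))|exact HR|exact HR'|].
    rewrite S_INR; unfold one, zero; destruct n; simpl; unfold Re, Im; ring.
  - intros n x; unfold F.
    destruct (is_derive_CDerive_n f n x Sf) as [_ HR].
    destruct (is_derive_CDerive_n f (pred n) x Sf) as [_ HR'].
    apply is_derive_ext_R with
      (fun y => y * Im (CDerive_n f n y) + INR n * Im (CDerive_n f (pred n) y)).
    { intros y; simpl; unfold Re, Im; ring. }
    eapply is_derive_mult_plus_mult;
      [apply is_derive_id|apply (is_derive_const (INR n))|exact HR|exact HR'|].
    rewrite S_INR; unfold one, zero; destruct n; simpl; unfold Re, Im; ring.
  - intros m n.
    (* The factor x raises the weight of the first summand from m to m + 1. *)
    destruct (proj2 (schwartz_prop f) (S m) n) as [A HA].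
    destruct (proj2 (schwartz_prop f) m (pred n)) as [B HB].
    exists (A + Cmod (INR n) * B); intros x; unfold F.
    apply weighted_Cmod_plus; [apply pow_le, Rabs_pos| |apply weighted_Cmod_mult, HB].
    rewrite Cmod_mult, Cmod_R; specialize (HA x); simpl in HA; lra.
Qed.

Definition schwartz_mulx (f : schwartz) : schwartz :=
  mk_schwartz (fun x => (RtoC x * f x)%C) (is_schwartz_mulx f).

Lemma CDerive_1_eq (f : R -> C) (x : R) (l : C) :
  is_derive (fun y => Re (f y)) x (Re l) -> is_derive (fun y => Im (f y)) x (Im l) ->
  CDerive_n f 1 x = l.
Proof.
  intros HR HI; apply injective_projections;
    [exact (is_derive_unique _ _ _ HR)|exact (is_derive_unique _ _ _ HI)].
Qed.

Lemma schwartz_derive_mulx (f : schwartz) (x : R) :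
  schwartz_derive (schwartz_mulx f) x = (f x + RtoC x * schwartz_derive f x)%C.
Proof.
  destruct (is_derive_CDerive_n f 0 x (proj1 (schwartz_prop f))) as [HR HI].
  change (CDerive_n f 1) with (schwartz_fun (schwartz_derive f)) in HR, HI.
  set (f' := schwartz_derive f) in *.
  apply CDerive_1_eq.
  (* The dummy summand [0 * 0] gives the single product the shape p u + q v. *)
  - apply is_derive_ext_R with (fun y => y * Re (f y) + 0 * 0);
      [intros y; simpl; unfold Re, Im; ring|].
    eapply (is_derive_mult_plus_mult _ (fun _ => 0) _ (fun _ => 0));
      [apply is_derive_id|apply is_derive_const|exact HR|apply is_derive_const|].
    unfold one, zero; simpl; unfold Re, Im; ring.
  - apply is_derive_ext_R with (fun y => y * Im (f y) + 0 * 0);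
      [intros y; simpl; unfold Re, Im; ring|].
    eapply (is_derive_mult_plus_mult _ (fun _ => 0) _ (fun _ => 0));
      [apply is_derive_id|apply is_derive_const|exact HI|apply is_derive_const|].
    unfold one, zero; simpl; unfold Re, Im; ring.
Qed.

Lemma schwartz_derive_modulate (h : R) (f : schwartz) (x : R) :
  schwartz_derive (schwartz_modulate h f) x =
  (Cexp (Ci * RtoC h * RtoC x) * (schwartz_derive f x + Ci * RtoC h * f x))%C.
Proof.
  destruct (is_derive_CDerive_n f 0 x (proj1 (schwartz_prop f))) as [HR HI].
  change (CDerive_n f 1) with (schwartz_fun (schwartz_derive f)) in HR, HI.
  set (f' := schwartz_derive f) in *.
  assert (HC : is_derive (fun y => cos (h * y)) x (- h * sin (h * x)))
    by (auto_derive; [exact I|ring]).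
  assert (HS : is_derive (fun y => sin (h * y)) x (h * cos (h * x)))
    by (auto_derive; [exact I|ring]).
  apply CDerive_1_eq; rewrite Cexp_Ci.
  - apply is_derive_ext_R with
      (fun y => cos (h * y) * Re (f y) + sin (h * y) * - Im (f y)).
    { intros y; cbn [schwartz_modulate schwartz_fun]; rewrite Cexp_Ci.
      simpl; unfold Re, Im; ring. }
    eapply (is_derive_mult_plus_mult _ _ _ (fun y => - Im (f y)));
      [exact HC|exact HS|exact HR|exact (is_derive_opp _ _ _ HI)|].
    unfold opp; simpl; unfold Re, Im; ring.
  - apply is_derive_ext_R with
      (fun y => cos (h * y) * Im (f y) + sin (h * y) * Re (f y)).
    { intros y; cbn [schwartz_modulate schwartz_fun]; rewrite Cexp_Ci; reflexivity. }
    eapply is_derive_mult_plus_mult; [exact HC|exact HS|exact HI|exact HR|].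
    simpl; unfold Re, Im; ring.
Qed.

(** * Taylor remainders of the modulation in h *)

(** The first-order remainder (e^{ihx} - 1) f(x), assembled from Schwartz operations so that [T] and
    the seminorms apply to it. *)
Definition modulate_diff1 (h : R) (f : schwartz) : schwartz :=
  schwartz_plus (schwartz_modulate h f) (schwartz_scal (- (1))%C f).

(** The second-order remainder (e^{ihx} - 1 - ihx) f(x). *)
Definition modulate_diff2 (h : R) (f : schwartz) : schwartz :=
  schwartz_plus (modulate_diff1 h f) (schwartz_scal (- (Ci * RtoC h))%C (schwartz_mulx f)).

Lemma schwartz_derive_plus (f g : schwartz) (x : R) :
  schwartz_derive (schwartz_plus f g) x = (schwartz_derive f x + schwartz_derive g x)%C.
Proof. apply CDerive_n_plus. Qed.

Lemma schwartz_derive_scal (c : C) (f : schwartz) (x : R) :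
  schwartz_derive (schwartz_scal c f) x = (c * schwartz_derive f x)%C.
Proof. apply CDerive_n_scal. Qed.

(** The term ih e^{ihx} f is split as ih ((e^{ihx} - 1) f + f), so that only remainders and f itself
    occur and an induction can close. *)
Lemma schwartz_derive_diff1 (h : R) (f : schwartz) :
  schwartz_derive (modulate_diff1 h f) =
  schwartz_plus (modulate_diff1 h (schwartz_derive f))
    (schwartz_scal (Ci * RtoC h)%C (schwartz_plus (modulate_diff1 h f) f)).
Proof.
  apply schwartz_ext; intros x; unfold modulate_diff1.
  rewrite schwartz_derive_plus, schwartz_derive_modulate, schwartz_derive_scal.
  simpl; ring.
Qed.

Lemma schwartz_derive_diff2 (h : R) (f : schwartz) :
  schwartz_derive (modulate_diff2 h f) =
  schwartz_plus (modulate_diff2 h (schwartz_derive f))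
    (schwartz_scal (Ci * RtoC h)%C (modulate_diff1 h f)).
Proof.
  apply schwartz_ext; intros x; unfold modulate_diff2.
  rewrite schwartz_derive_plus, schwartz_derive_scal, schwartz_derive_mulx.
  rewrite schwartz_derive_diff1; simpl; ring.
Qed.

(** * Elementary bounds on e^{ihx} - 1 and e^{ihx} - 1 - ihx *)

Lemma Cmod_le_Rabs_plus (z : C) : Cmod z <= Rabs (Re z) + Rabs (Im z).
Proof.
  destruct z as [u v]; simpl.
  replace (u, v) with (RtoC u + Ci * RtoC v)%C
    by (apply injective_projections; simpl; unfold Re, Im; ring).
  eapply Rle_trans; [apply Cmod_triangle|].
  rewrite Cmod_mult, !Cmod_R, Cmod_Ci; lra.
Qed.

(** Mean value inequality between 0 and x, with |cos| <= 1. The two linear bounds, for sin and for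
    cos - 1, then control the derivatives in the two quadratic ones. *)
Lemma Rabs_sin_le (x : R) : Rabs (sin x) <= Rabs x.
Proof.
  generalize (bounded_variation sin cos 1 0 x); rewrite sin_0, !Rminus_0_r, Rmult_1_l.
  intros H; apply H; intros t _; split; [apply is_derive_sin|].
  apply Rabs_le, COS_bound.
Qed.

Lemma Rabs_cos_minus_1_le (x : R) : Rabs (cos x - 1) <= Rabs x.
Proof.
  generalize (bounded_variation cos (fun t => - sin t) 1 0 x).
  rewrite cos_0, !Rminus_0_r, Rmult_1_l.
  intros H; apply H; intros t _; split; [apply is_derive_cos|].
  rewrite Rabs_Ropp; apply Rabs_le, SIN_bound.
Qed.

Lemma Rabs_cos_minus_1_le_sqr (x : R) : Rabs (cos x - 1) <= Rabs x * Rabs x.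
Proof.
  generalize (bounded_variation cos (fun t => - sin t) (Rabs x) 0 x).
  rewrite cos_0, !Rminus_0_r.
  intros H; apply H; intros t Ht; rewrite Rminus_0_r in Ht; split; [apply is_derive_cos|].
  rewrite Rabs_Ropp; eapply Rle_trans; [apply Rabs_sin_le|exact Ht].
Qed.

Lemma Rabs_sin_minus_id_le_sqr (x : R) : Rabs (sin x - x) <= Rabs x * Rabs x.
Proof.
  generalize (bounded_variation (fun t => sin t - t) (fun t => cos t - 1) (Rabs x) 0 x).
  rewrite sin_0, !Rminus_0_r.
  intros H; apply H; intros t Ht; rewrite Rminus_0_r in Ht; split.
  - auto_derive; [exact I|ring].
  - eapply Rle_trans; [apply Rabs_cos_minus_1_le|exact Ht].
Qed.

Lemma Cmod_Cexp_Ci_minus_1 (h x : R) :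
  Cmod (Cexp (Ci * RtoC h * RtoC x) - 1)%C <= 2 * Rabs (h * x).
Proof.
  rewrite Cexp_Ci; eapply Rle_trans; [apply Cmod_le_Rabs_plus|]; simpl.
  replace (sin (h * x) + - 0) with (sin (h * x)) by ring.
  generalize (Rabs_sin_le (h * x)) (Rabs_cos_minus_1_le (h * x)); unfold Rminus; lra.
Qed.

Lemma Cmod_Cexp_Ci_minus_affine (h x : R) :
  Cmod (Cexp (Ci * RtoC h * RtoC x) - 1 - Ci * RtoC h * RtoC x)%C
  <= 2 * (Rabs (h * x) * Rabs (h * x)).
Proof.
  rewrite Cexp_Ci; eapply Rle_trans; [apply Cmod_le_Rabs_plus|]; simpl.
  match goal with |- Rabs ?u + Rabs ?v <= _ =>
    replace u with (cos (h * x) - 1) by ring;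
    replace v with (sin (h * x) - h * x) by ring end.
  generalize (Rabs_sin_minus_id_le_sqr (h * x)) (Rabs_cos_minus_1_le_sqr (h * x)); lra.
Qed.

(** * Seminorm bounds for the remainders *)

(** Induction on the order [n], for all [f] at once since the step also uses the hypothesis at f'.
    The constant [L] is independent of h. *)
Lemma modulate_diff1_bound (n : nat) : forall (f : schwartz) (m : nat),
  exists L : R, forall h x : R, Rabs h <= 1 ->
    Rabs x ^ m * Cmod (CDerive_n (modulate_diff1 h f) n x) <= L * Rabs h.
Proof.
  induction n as [|n IH]; intros f m.
  (* The factor |x| in |e^{ihx} - 1| <= 2 |hx| is absorbed into the weight m + 1. *)
  - destruct (proj2 (schwartz_prop f) (S m) 0%nat) as [A HA].
    exists (2 * A); intros h x _; rewrite CDerive_n_0.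
    specialize (HA x); rewrite CDerive_n_0 in HA; simpl in HA |- *.
    replace (Cexp (Ci * h * x) * f x + - (1) * f x)%C
      with ((Cexp (Ci * h * x) - 1) * f x)%C by (ring).
    rewrite Cmod_mult.
    generalize (Cmod_Cexp_Ci_minus_1 h x); rewrite Rabs_mult; intros H.
    assert (Hw : 0 <= Rabs x ^ m * Cmod (f x))
      by (apply Rmult_le_pos; [apply pow_le, Rabs_pos|apply Cmod_ge_0]).
    apply Rmult_le_compat_l with (r := Rabs x ^ m * Cmod (f x)) in H; [|exact Hw].
    apply Rmult_le_compat_l with (r := Rabs h) in HA; [|apply Rabs_pos].
    lra.
  - destruct (IH (schwartz_derive f) m) as [A HA].
    destruct (IH f m) as [B HB].
    destruct (proj2 (schwartz_prop f) m n) as [D HD].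
    (* [A] bounds the remainder of f'. In ih ((e^{ihx} - 1) f + f) the outer factor supplies |h|,
       and the bracket is at most B |h| + D <= B + D. *)
    exists (A + (B * 1 + D)); intros h x Hh.
    rewrite <- CDerive_n_derive, schwartz_derive_diff1, CDerive_n_plus, CDerive_n_scal,
      CDerive_n_plus.
    assert (Hw : 0 <= Rabs x ^ m) by apply pow_le, Rabs_pos.
    rewrite Rmult_plus_distr_r; apply weighted_Cmod_plus; [exact Hw|auto|].
    eapply Rle_trans.
    { apply weighted_Cmod_mult, weighted_Cmod_plus; [exact Hw| |apply HD].
      eapply Rle_trans; [apply HB, Hh|].
      apply Rmult_le_compat_l with (r2 := 1); [|exact Hh].
      (* The case h = 1 of the bound shows that [B] is nonnegative. *)
      specialize (HB 1 x ltac:(rewrite Rabs_R1; lra)); rewrite Rabs_R1, Rmult_1_r in HB.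
      eapply Rle_trans; [|exact HB]; apply Rmult_le_pos; [exact Hw|apply Cmod_ge_0]. }
    rewrite Cmod_mult, Cmod_Ci, Cmod_R; lra.
Qed.

(** At order 0 the factor |hx|^2 costs two powers of x, hence the weight m + 2. In the step, the
    extra term ih (e^{ihx} - 1) f gets one |h| from its coefficient and one from the first-order
    bound. *)
Lemma modulate_diff2_bound (n : nat) : forall (f : schwartz) (m : nat),
  exists L : R, forall h x : R, Rabs h <= 1 ->
    Rabs x ^ m * Cmod (CDerive_n (modulate_diff2 h f) n x) <= L * (Rabs h * Rabs h).
Proof.
  induction n as [|n IH]; intros f m.
  - destruct (proj2 (schwartz_prop f) (S (S m)) 0%nat) as [A HA].
    exists (2 * A); intros h x _; rewrite CDerive_n_0.
    specialize (HA x); rewrite CDerive_n_0 in HA; simpl in HA |- *.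
    replace (Cexp (Ci * h * x) * f x + - (1) * f x + - (Ci * h) * (x * f x))%C
      with ((Cexp (Ci * h * x) - 1 - Ci * h * x) * f x)%C by (ring).
    rewrite Cmod_mult.
    generalize (Cmod_Cexp_Ci_minus_affine h x); rewrite Rabs_mult; intros H.
    assert (Hw : 0 <= Rabs x ^ m * Cmod (f x))
      by (apply Rmult_le_pos; [apply pow_le, Rabs_pos|apply Cmod_ge_0]).
    apply Rmult_le_compat_l with (r := Rabs x ^ m * Cmod (f x)) in H; [|exact Hw].
    apply Rmult_le_compat_l with (r := Rabs h * Rabs h) in HA;
      [|apply Rmult_le_pos; apply Rabs_pos].
    lra.
  - destruct (IH (schwartz_derive f) m) as [A HA].
    destruct (modulate_diff1_bound n f m) as [B HB].
    exists (A + B); intros h x Hh.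
    rewrite <- CDerive_n_derive, schwartz_derive_diff2, CDerive_n_plus, CDerive_n_scal.
    rewrite Rmult_plus_distr_r; apply weighted_Cmod_plus;
      [apply pow_le, Rabs_pos|auto|].
    eapply Rle_trans; [apply weighted_Cmod_mult, HB, Hh|].
    rewrite Cmod_mult, Cmod_Ci, Cmod_R; lra.
Qed.

(** * Differentiability of the weak characteristic function *)

(** A tempered distribution is controlled by finitely many seminorms; this merges their separate
    constants into one by taking maxima. *)
Lemma common_bound (P : nat -> R -> Prop) :
  (forall m L L', L <= L' -> P m L -> P m L') -> (forall m, exists L, P m L) ->
  forall N, exists L, forall m, (m <= N)%nat -> P m L.
Proof.
  intros Hmono HP; induction N as [|N [L HL]].
  - destruct (HP 0%nat) as [L HL]; exists L; intros m Hm.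
    replace m with 0%nat by lia; exact HL.
  - destruct (HP (S N)) as [L' HL']; exists (Rmax L L'); intros m Hm.
    destruct (Nat.eq_dec m (S N)) as [->|Hne].
    + eapply Hmono; [apply Rmax_r|exact HL'].
    + eapply Hmono; [apply Rmax_l|apply HL; lia].
Qed.

(** Continuity at zero bounds T on a neighbourhood of zero, and a multiple of [g] lies in it. A
    positive upper bound [L] replaces the maximum of the seminorms, so that the scaling can divide
    by it. *)
Lemma tempered_bound (T : tempered) (f : schwartz) :
  exists (N : nat) (c : R), forall (g : schwartz) (L : R), 0 < L ->
    (forall m n x, (m <= N)%nat -> (n <= N)%nat ->
       Rabs x ^ m * Cmod (CDerive_n g n x) <= L) ->
    Cmod (T g) <= c * L.
Proof.
  (* f only provides a Schwartz function to build zero from. *)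
  set (O := schwartz_scal 0%C f).
  assert (TO : T O = 0%C) by (unfold O; rewrite tempered_scal; ring).
  destruct (tempered_continuous T O _ (locally_ball (T O) (mkposreal 1 Rlt_0_1)))
    as [N [r HN]].
  (* With s = r / (2L), the seminorms of s g are at most r/2. The unit ball of C is taken
     componentwise, so |T (s g)| <= 2 and |T g| <= 2/s = (4/r) L. *)
  exists N, (4 / r); intros g L HL Hg; assert (Hr := cond_pos r).
  set (s := r / (2 * L)).
  assert (Hs : 0 < s) by (apply Rdiv_lt_0_compat; lra).
  assert (HB : ball (T O) 1 (T (schwartz_scal (RtoC s) g))).
  { apply HN; intros m n Hm Hn.
    replace (fun x => (schwartz_scal s g x - O x)%C)
      with (schwartz_fun (schwartz_scal (RtoC s) g))
      by (apply functional_extensionality; intros x; simpl; ring).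
    apply Rle_lt_trans with (s * L); [|unfold s; apply Rminus_lt_0; field_simplify; lra].
    apply seminorm_le; intros x; rewrite CDerive_n_scal.
    eapply Rle_trans; [apply weighted_Cmod_mult, Hg; assumption|].
    rewrite Cmod_R, Rabs_pos_eq; lra. }
  rewrite TO, tempered_scal in HB; destruct HB as [HR HI].
  assert (H : Cmod (RtoC s * T g)%C <= 2).
  { eapply Rle_trans; [apply Cmod_le_Rabs_plus|].
    unfold ball in HR, HI; simpl in HR, HI; unfold AbsRing_ball, abs, minus, plus, opp in HR, HI.
    simpl in HR, HI.
    rewrite Ropp_0, Rplus_0_r in HR, HI.
    simpl; lra. }
  rewrite Cmod_mult, Cmod_R, Rabs_pos_eq in H by lra.
  replace (4 / r * L) with (/ s * 2) by (unfold s; field; lra).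
  apply Rmult_le_reg_l with s; [exact Hs|].
  replace (s * (/ s * 2)) with 2 by (field; lra); exact H.
Qed.

(** The difference quotient is within |K| |h| of [l]. The denominator |K| + 1 in the choice of delta
    is positive whatever the sign of [K]. *)
Lemma is_derive_of_quadratic_error (f : R -> R) (x l K : R) :
  (forall h, h <> 0 -> Rabs h <= 1 -> Rabs (f (x + h) - f x - h * l) <= K * (Rabs h * Rabs h)) ->
  is_derive f x l.
Proof.
  intros H; apply is_derive_Reals; intros eps Heps.
  assert (HK := Rabs_pos K).
  assert (Hd : 0 < Rmin 1 (eps / (Rabs K + 1)))
    by (apply Rmin_pos; [lra|apply Rdiv_lt_0_compat; lra]).
  exists (mkposreal _ Hd); intros h Hh Hlt; simpl in Hlt.
  assert (H1 := Rlt_le_trans _ _ _ Hlt (Rmin_l _ _)).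
  assert (H2 := Rlt_le_trans _ _ _ Hlt (Rmin_r _ _)).
  specialize (H h Hh (Rlt_le _ _ H1)).
  assert (Hp := Rabs_pos_lt h Hh).
  replace ((f (x + h) - f x) / h - l) with ((f (x + h) - f x - h * l) / h) by (field; exact Hh).
  unfold Rdiv; rewrite Rabs_mult, Rabs_inv.
  apply Rle_lt_trans with (Rabs K * Rabs h).
  - apply Rmult_le_reg_r with (Rabs h); [exact Hp|].
    replace (Rabs (f (x + h) - f x - h * l) * / Rabs h * Rabs h)
      with (Rabs (f (x + h) - f x - h * l)) by (field; lra).
    eapply Rle_trans; [exact H|].
    rewrite Rmult_assoc; apply Rmult_le_compat_r; [nra|apply Rle_abs].
  - apply Rle_lt_trans with ((Rabs K + 1) * Rabs h); [nra|].
    replace eps with ((Rabs K + 1) * (eps / (Rabs K + 1))) by (field; lra).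
    apply Rmult_lt_compat_l; lra.
Qed.

Lemma Cexp_plus (z w : C) : Cexp (z + w)%C = (Cexp z * Cexp w)%C.
Proof.
  destruct z as [z1 z2], w as [w1 w2]; unfold Cexp; simpl.
  rewrite exp_plus, cos_plus, sin_plus.
  apply injective_projections; simpl; ring.
Qed.

(** Since e^{i(t+h)x} = e^{ihx} e^{itx}, expanding at t amounts to expanding at 0 with e^{itx} f in
    place of f, so the remainder bounds serve at every t. *)
Lemma schwartz_modulate_plus (t h : R) (f : schwartz) :
  schwartz_modulate (t + h) f =
  schwartz_plus (modulate_diff2 h (schwartz_modulate t f))
    (schwartz_plus (schwartz_modulate t f)
       (schwartz_scal (Ci * RtoC h)%C (schwartz_mulx (schwartz_modulate t f)))).
Proof.
  apply schwartz_ext; intros x; unfold modulate_diff2, modulate_diff1; simpl.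
  replace (Ci * (t + h)%R * x)%C with (Ci * h * x + Ci * t * x)%C
    by (rewrite RtoC_plus; ring).
  rewrite Cexp_plus; ring.
Qed.

Lemma ex_derive_weak_cf (T : tempered) (phi : schwartz) (t : R) :
  ex_derive (fun s => Re (weak_cf T phi s)) t /\
  ex_derive (fun s => Im (weak_cf T phi s)) t.
Proof.
  set (psi := schwartz_modulate t phi).
  (* The expected derivative: differentiation under the pairing gives <T, i x e^{itx} phi(x)>. *)
  set (l := (Ci * T (schwartz_mulx psi))%C).
  destruct (tempered_bound T psi) as [N [c Hc]].
  assert (HL : exists L, forall m, (m <= N)%nat -> forall n, (n <= N)%nat ->
    forall h x, Rabs h <= 1 ->
    Rabs x ^ m * Cmod (CDerive_n (modulate_diff2 h psi) n x) <= L * (Rabs h * Rabs h)).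
  { assert (Hmono : forall A B h z, A <= B -> z <= A * (Rabs h * Rabs h) ->
      z <= B * (Rabs h * Rabs h)).
    { intros A B h z HAB Hz; eapply Rle_trans; [exact Hz|].
      apply Rmult_le_compat_r; [apply Rmult_le_pos; apply Rabs_pos|exact HAB]. }
    apply (common_bound (fun m L => forall n, (n <= N)%nat -> forall h x, Rabs h <= 1 ->
      Rabs x ^ m * Cmod (CDerive_n (modulate_diff2 h psi) n x) <= L * (Rabs h * Rabs h))).
    { intros m A B HAB HA n Hn h x Hh; apply Hmono with A; auto. }
    intros m; apply (common_bound (fun n L => forall h x, Rabs h <= 1 ->
      Rabs x ^ m * Cmod (CDerive_n (modulate_diff2 h psi) n x) <= L * (Rabs h * Rabs h))).
    { intros n A B HAB HA h x Hh; apply Hmono with A; auto. }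
    intros n; apply modulate_diff2_bound. }
  destruct HL as [L HL].
  (* [tempered_bound] asks for a strictly positive bound: hence [Rmax 1 L], and h nonzero. *)
  assert (H : forall h, h <> 0 -> Rabs h <= 1 ->
    Cmod (weak_cf T phi (t + h) - weak_cf T phi t - RtoC h * l)%C
    <= c * Rmax 1 L * (Rabs h * Rabs h)).
  { intros h Hh Hh1.
    replace (weak_cf T phi (t + h) - weak_cf T phi t - h * l)%C
      with (T (modulate_diff2 h psi)).
    2:{ unfold weak_cf at 1; rewrite schwartz_modulate_plus, !tempered_plus, tempered_scal.
        unfold l, weak_cf; fold psi; ring. }
    assert (Hp := Rabs_pos_lt h Hh).
    assert (Hhh : 0 < Rabs h * Rabs h) by nra.
    rewrite Rmult_assoc; apply Hc.
    - apply Rmult_lt_0_compat; [|exact Hhh].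
      apply Rlt_le_trans with 1; [lra|apply Rmax_l].
    - intros m n x Hm Hn; eapply Rle_trans; [apply HL; auto|].
      apply Rmult_le_compat_r; [lra|apply Rmax_r]. }
  assert (HZ : forall z : C, Rabs (Re z) <= Cmod z /\ Rabs (Im z) <= Cmod z).
  { intros z; generalize (Rmax_Cmod z) (Rmax_l (Rabs (fst z)) (Rabs (snd z)))
      (Rmax_r (Rabs (fst z)) (Rabs (snd z))); unfold Re, Im; lra. }
  split; [exists (Re l)|exists (Im l)];
    apply is_derive_of_quadratic_error with (c * Rmax 1 L); intros h Hh Hh1;
    (eapply Rle_trans; [|apply (H h Hh Hh1)]).
  - eapply Rle_trans; [|apply (proj1 (HZ _))]; right; f_equal; generalize l; intros z.
    destruct (weak_cf T phi (t + h)), (weak_cf T phi t), z; simpl; ring.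
  - eapply Rle_trans; [|apply (proj2 (HZ _))]; right; f_equal; generalize l; intros z.
    destruct (weak_cf T phi (t + h)), (weak_cf T phi t), z; simpl; ring.
Qed.

(** * Complex logarithms and a differentiable branch *)

Lemma Cexp_polar (r theta : R) :
  0 < r -> Cexp (ln r, theta) = (r * cos theta, r * sin theta).
Proof. intros Hr; unfold Cexp; simpl; rewrite exp_ln by exact Hr; reflexivity. Qed.

(** The principal logarithm: on the right half-plane the argument is atan (v/u), and cos and sin of
    it have closed forms. *)
Lemma Cexp_log (z : C) :
  0 < Re z -> Cexp (ln (Cmod z), atan (Im z / Re z)) = z.
Proof.
  destruct z as [u v]; simpl; intros Hu.
  rewrite Cexp_polar by (apply Cmod_gt_0; intros H; injection H; lra).
  set (q := v / u).
  assert (Hq : 0 < 1 + Rsqr q) by (generalize (Rle_0_sqr q); lra).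
  assert (Hs := sqrt_lt_R0 _ Hq).
  assert (E : Cmod (u, v) = u * sqrt (1 + Rsqr q)).
  { unfold Cmod; simpl.
    replace (u * sqrt (1 + Rsqr q)) with (sqrt (u * u) * sqrt (1 + Rsqr q))
      by (rewrite sqrt_square; lra).
    rewrite <- sqrt_mult by nra; f_equal; unfold q, Rsqr; field; lra. }
  rewrite E, cos_atan, sin_atan; apply injective_projections; simpl.
  - field; lra.
  - unfold q at 2; field; lra.
Qed.

(** Polar form: acos (u/r) has the right cosine, and its sine is |v/r|, so the angle takes the sign
    of v. *)
Lemma Cexp_onto (z : C) : z <> 0%C -> exists c, Cexp c = z.
Proof.
  intros Hz; assert (Hm := proj1 (Cmod_gt_0 z) Hz).
  destruct z as [u v]; set (r := Cmod (u, v)) in *.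
  assert (E : r * r = u * u + v * v).
  { unfold r, Cmod; simpl; rewrite sqrt_sqrt by nra; ring. }
  assert (Hx : Rsqr (u / r) + Rsqr (v / r) = 1).
  { unfold Rsqr; replace 1 with ((u * u + v * v) / (r * r)); [field; lra|].
    rewrite E; field; nra. }
  assert (Hb : -1 <= u / r <= 1)
    by (generalize (Rle_0_sqr (v / r)); unfold Rsqr in *; nra).
  assert (Hc := cos_acos _ Hb); assert (Hs := sin_acos _ Hb).
  replace (1 - Rsqr (u / r)) with (Rsqr (v / r)) in Hs by lra.
  rewrite sqrt_Rsqr_abs in Hs.
  destruct (Rle_dec 0 (v / r)) as [Hv|Hv].
  - exists (ln r, acos (u / r)); rewrite Cexp_polar, Hc, Hs, Rabs_pos_eq by lra.
    apply injective_projections; simpl; field; lra.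
  - exists (ln r, - acos (u / r)).
    rewrite Cexp_polar, cos_neg, sin_neg, Hc, Hs, Rabs_left by lra.
    apply injective_projections; simpl; field; lra.
Qed.

(** Division by f(0) moves the values near 0 into the right half-plane, where the principal
    logarithm is differentiable; a constant [c] with e^c = f(0) undoes the division. *)
Lemma exists_derivable_log_branch (f : R -> C) :
  (forall t, ex_derive (fun s => Re (f s)) t) ->
  (forall t, ex_derive (fun s => Im (f s)) t) ->
  f 0 <> 0%C ->
  exists K, is_log_branch f K /\ locally 0 (fun t => ex_derive (fun s => Im (K s)) t).
Proof.
  intros HR HI H0; destruct (Cexp_onto _ H0) as [c Hc].
  set (w := fun t => (f t / f 0)%C).
  set (u := fun t => Re (w t)); set (v := fun t => Im (w t)).
  set (ab := (/ f 0)%C).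
  assert (Hu : forall t, ex_derive u t).
  { intros t; apply (ex_derive_minus (fun s => Re (f s) * Re ab) (fun s => Im (f s) * Im ab));
      apply ex_derive_mult; auto; apply ex_derive_const. }
  assert (Hv : forall t, ex_derive v t).
  { intros t; apply (ex_derive_plus (fun s => Re (f s) * Im ab) (fun s => Im (f s) * Re ab));
      apply ex_derive_mult; auto; apply ex_derive_const. }
  (* [u] is continuous and equals 1 at 0. *)
  assert (Hpos : locally 0 (fun t => 0 < u t)).
  { apply (ex_derive_continuous u 0 (Hu 0)), open_gt.
    unfold u, w; replace (f 0 / f 0)%C with (RtoC 1) by (field; exact H0); simpl; lra. }
  (* The modulus and the argument are written through [u] and [v], so that [auto_derive] can
     differentiate them. *)
  set (K := fun t => (c + (ln (sqrt (u t ^ 2 + v t ^ 2)), atan (v t / u t)))%C).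
  assert (HK : forall t, 0 < u t ->
    ex_derive (fun s => Re (K s)) t /\ ex_derive (fun s => Im (K s)) t).
  { intros t Ht; split.
    - assert (Hs : 0 < u t ^ 2 + v t ^ 2) by nra.
      apply (ex_derive_plus (fun _ => Re c) (fun s => ln (sqrt (u s ^ 2 + v s ^ 2))));
        [apply ex_derive_const|].
      auto_derive; repeat split; auto.
      exact (sqrt_lt_R0 _ Hs).
    - apply (ex_derive_plus (fun _ => Im c) (fun s => atan (v s / u s)));
        [apply ex_derive_const|].
      auto_derive; repeat split; auto; lra. }
  exists K; unfold is_log_branch; split; revert Hpos; apply filter_imp; intros t Ht.
  - destruct (HK t Ht) as [KR KI]; split.
    + apply (continuous_ext (fun s => (Re (K s), Im (K s)))).
      { intros s; destruct (K s); reflexivity. }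
      apply (continuous_comp_2 (fun s => Re (K s)) (fun s => Im (K s)) (fun x y => (x, y)));
        [exact (ex_derive_continuous _ _ KR)|exact (ex_derive_continuous _ _ KI)|].
      apply (continuous_ext (fun p => p)); [intros [x y]; reflexivity|apply continuous_id].
    + unfold K; rewrite Cexp_plus, Hc.
      change (f 0 * Cexp (ln (Cmod (w t)), atan (Im (w t) / Re (w t))) = f t)%C.
      rewrite Cexp_log by exact Ht; unfold w; field; exact H0.
  - apply (HK t Ht).
Qed.

(** * The linear term and the translated pair *)

Lemma Derive_plus_linear (f : R -> R) (c x : R) :
  ex_derive f x -> Derive (fun t => f t + c * t) x = Derive f x + c.
Proof.
  intros H; rewrite (Derive_plus f (fun t => c * t)); [|exact H|auto_derive; exact I].
  rewrite Derive_scal, Derive_id; ring.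
Qed.

(* Differentiability near x only: after one derivative the summand is constant,
   and [Derive] ignores additive constants even where no derivative exists. *)
Lemma Derive_n_plus_linear (f : R -> R) (c x : R) (n : nat) :
  (2 <= n)%nat -> locally x (ex_derive f) ->
  Derive_n (fun t => f t + c * t) n x = Derive_n f n x.
Proof.
  intros Hn H; destruct n as [|[|n]]; [lia|lia|].
  rewrite <- (Nat.add_1_r (S n)), <- !(Derive_n_comp _ (S n) 1).
  rewrite (Derive_n_ext_loc _ (fun t => Derive f t + c)).
  2:{ revert H; apply filter_imp; intros t Ht; apply (Derive_plus_linear f c t Ht). }
  rewrite <- (Nat.add_1_r n), <- !Derive_n_comp.
  apply Derive_n_ext; intros t; simpl; unfold Derive; f_equal.
  apply Lim_ext; intros h; f_equal; ring.
Qed.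

(** The two shifts cancel on phi and leave e^{it(x+a)} phi(x); the constant e^{ita} comes out by
    linearity. *)
Lemma weak_cf_translate (T : tempered) (phi : schwartz) (a t : R) :
  weak_cf (tempered_translate a T) (schwartz_translate a phi) t
  = (Cexp (Ci * RtoC t * RtoC a) * weak_cf T phi t)%C.
Proof.
  unfold weak_cf; simpl; rewrite <- tempered_scal; f_equal; apply schwartz_ext.
  intros x; simpl.
  replace (x + a + - a) with x by ring.
  replace (Ci * t * (x + a)%R)%C with (Ci * t * a + Ci * t * x)%C
    by (rewrite RtoC_plus; ring).
  rewrite Cexp_plus; ring.
Qed.

Theorem proposition3p7 (T : tempered) (phi : schwartz) (a : R) :
  (forall t : R,
     weak_cf (tempered_translate a T) (schwartz_translate a phi) t
     = (Cexp (Ci * RtoC t * RtoC a) * weak_cf T phi t)%C) /\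
  (nonzero_near_0 (weak_cf T phi) ->
     weak_cumulant (tempered_translate a T) (schwartz_translate a phi) 1
     = (weak_cumulant T phi 1 + RtoC a)%C /\
     (forall n : nat, (2 <= n)%nat ->
        weak_cumulant (tempered_translate a T) (schwartz_translate a phi) n
        = weak_cumulant T phi n)).
Proof.
  split; [apply weak_cf_translate|intros H0].
  destruct (exists_derivable_log_branch (weak_cf T phi)) as [K [HK DK]].
  { intros t; exact (proj1 (ex_derive_weak_cf T phi t)). }
  { intros t; exact (proj2 (ex_derive_weak_cf T phi t)). }
  { exact (locally_singleton _ _ H0). }
  set (Ka := fun t => (K t + Ci * RtoC t * RtoC a)%C).
  assert (HKa : is_log_branch
    (weak_cf (tempered_translate a T) (schwartz_translate a phi)) Ka).
  { unfold is_log_branch.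
    apply (filter_imp (fun t => continuous K t /\ Cexp (K t) = weak_cf T phi t)); [|exact HK].
    intros t [CK EK]; split.
    - apply (continuous_plus K (fun t : R => (Ci * RtoC t * RtoC a)%C)); [exact CK|].
      (* As a real multiple of the fixed number ia, the added term is visibly continuous. *)
      apply (continuous_ext (fun s : R => scal s (Ci * RtoC a)%C)).
      { intros s; apply injective_projections; simpl; unfold scal; simpl; unfold mult; simpl;
          ring. }
      exact (continuous_scal_l (fun s : R => s) (Ci * RtoC a)%C t (continuous_id t)).
    - unfold Ka; rewrite Cexp_plus, EK, weak_cf_translate; ring. }
  (* The term ita is purely imaginary: only the imaginary part of the branch changes, by [a * s]. *)
  assert (HRe : forall n, Derive_n (fun s => Re (Ka s)) n 0 = Derive_n (fun s => Re (K s)) n 0).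
  { intros n; apply Derive_n_ext; intros s; simpl; unfold Re; ring. }
  assert (HIm : forall n, Derive_n (fun s => Im (Ka s)) n 0
    = Derive_n (fun s => Im (K s) + a * s) n 0).
  { intros n; apply Derive_n_ext; intros s; simpl; unfold Im; ring. }
  split.
  (* Cumulants may be read off any branch, here [Ka] and [K]. The derivative at 0 gains ia, which
     the factor 1/i turns into a. *)
  - rewrite (weak_cumulant_branch _ _ Ka), (weak_cumulant_branch _ _ K) by auto.
    unfold CDerive_n; rewrite HRe, HIm; simpl Derive_n.
    rewrite (Derive_plus_linear _ _ _ (locally_singleton _ _ DK)).
    set (p := Derive (fun s => Re (K s)) 0); set (q := Derive (fun s => Im (K s)) 0).
    change (/ Ci ^ 1 * (p, (q + a)%R) = / Ci ^ 1 * (p, q) + a)%C.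
    replace (p, q + a) with ((p, q) + Ci * RtoC a)%C
      by (apply injective_projections; simpl; ring).
    field; intros E; injection E; lra.
  - intros n Hn.
    (* From the second derivative on, the linear term leaves no trace. *)
    rewrite (weak_cumulant_branch _ _ Ka), (weak_cumulant_branch _ _ K) by (auto; lia).
    unfold CDerive_n; rewrite HRe, HIm, (Derive_n_plus_linear _ a 0 n Hn DK); reflexivity.
Qed.
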